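(* There are exactly $10$ equivalence classes (under the action of $S_6$ permuting the variables) of square free monomial Cremona sets $F$ of degree $3$ in $\mathbb{K}[x_1,\ldots,x_6]$ of type 3, i.e. such that the log matrix $A_F$ has neither a row with five entries equal to $1$ nor a row with exactly one entry equal to $1$.
   Context: $\mathbb{K}$ is a field. A monomial $f\in\mathbb{K}[x_1,\ldots,x_n]$ is square free if $x_i^2\nmid f$ for all $i$. For a set $F=\{f_1,\ldots,f_n\}$ of $n$ (distinct) monomials of the same degree $d$ in $\mathbb{K}[x_1,\ldots,x_n]$, the log matrix $A_F=(v_{ij})_{n\times n}$ is the matrix whose $j$-th column is the exponent vector of $f_j$, i.e. $f_j=x_1^{v_{1j}}\cdots x_n^{v_{nj}}$ (well defined up to permuting columns). $F$ is a square free set if all its monomials are square free. $F$ is a Cremona set if the rational map $\mathbb{P}^{n-1}\dashrightarrow\mathbb{P}^{n-1}$, $\underline{x}\mapsto(f_1(\underline{x}):\cdots:f_n(\underline{x}))$, is birational; algebraically, if $\mathbb{K}[f_1,\ldots,f_n]\subset \mathbb{K}[\underline{x}_d]$ becomes an equality at the level of fields of fractions, where $\mathbb{K}[\underline{x}_d]$ is the Veronese algebra generated by all monomials of degree $d$. The order of the elements of $F$ is irrelevant. $S_n$ acts on monomials by $\sigma*(x_1^{a_1}\cdots x_n^{a_n})=x_{\sigma(1)}^{a_1}\cdots x_{\sigma(n)}^{a_n}$ and on sets of monomials elementwise; two Cremona sets are equivalent if they lie in the same $S_n$-orbit. Here $n=6$, $d=3$. *)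

(* Defs.v *)
From mathcomp Require Import all_boot all_fingroup all_algebra.
From mathcomp Require Import finmap mpoly.

Set Implicit Arguments.
Unset Strict Implicit.
Unset Printing Implicit Defensive.

Import GRing.Theory.

Local Open Scope fset_scope.
Local Open Scope ring_scope.

(* A monomial of K[x_1, ..., x_n] is given by its exponent vector
   m : 'X_{1..n}; as a polynomial it is 'X_[m]. *)

(* (_ <= _)%MM is the componentwise order on exponents, i.e. divisibility of
   monomials (as opposed to the total monomial order (_ <= _)%O). *)
Definition square_free_mnm n (m : 'X_{1..n}) : Prop :=
  forall i : 'I_n, ~~ (U_(i) *+ 2 <= m)%MM.

Definition square_free_set n (F : {fset 'X_{1..n}}) : Prop :=
  forall m, m \in F -> square_free_mnm m.

(* The columns follow the enumeration order of F that finmap chooses. *)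
Definition log_matrix n (F : {fset 'X_{1..n}}) :
    'M[nat]_(n, size (enum_fset F)) :=
  \matrix_(i < n, j < size (enum_fset F)) tnth (in_tuple (enum_fset F)) j i.

Definition row_ones m n (A : 'M[nat]_(m, n)) (i : 'I_m) : nat :=
  #|[set j : 'I_n | A i j == 1%N]|.

Section Cremona.

Variables (K : fieldType) (n : nat).

Inductive subalg (S : {mpoly K[n]} -> Prop) : {mpoly K[n]} -> Prop :=
| subalg_scalar (c : K) : subalg S c%:MP
| subalg_gen p : S p -> subalg S p
| subalg_add p q : subalg S p -> subalg S q -> subalg S (p + q)
| subalg_mul p q : subalg S p -> subalg S q -> subalg S (p * q).

(* The field of fractions of the subring A, realized inside
   K(x_1, ..., x_n). *)
Definition frac_field (A : {mpoly K[n]} -> Prop)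
    (z : {fraction {mpoly K[n]}}) : Prop :=
  exists p q, [/\ A p, A q, q != 0 & z = tofrac p / tofrac q].

Definition monomial_alg (F : {fset 'X_{1..n}}) : {mpoly K[n]} -> Prop :=
  subalg (fun p => exists2 m, m \in F & p = 'X_[m]).

Definition veronese_alg (d : nat) : {mpoly K[n]} -> Prop :=
  subalg (fun p => exists2 m : 'X_{1..n}, mdeg m = d & p = 'X_[m]).

(* n monomials of the same degree d in n variables; birationality of
   x |-> (f_1(x) : ... : f_n(x)) is expressed by the equality
   Frac K[f_1, ..., f_n] = Frac K[x_d]. *)
Definition cremona_set (d : nat) (F : {fset 'X_{1..n}}) : Prop :=
  [/\ #|` F| = n,
      forall m, m \in F -> mdeg m = d
    & forall z, frac_field (monomial_alg F) z <-> frac_field (veronese_alg d) z].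

End Cremona.

(* s * (x_1^a_1 ... x_n^a_n) = x_{s 1}^a_1 ... x_{s n}^a_n, so the exponent of
   x_i in the result is a_{s^-1 i}. *)
Definition perm_mnm n (s : 'S_n) (m : 'X_{1..n}) : 'X_{1..n} :=
  [multinom m ((s^-1)%g i) | i < n].

Definition perm_set n (s : 'S_n) (F : {fset 'X_{1..n}}) : {fset 'X_{1..n}} :=
  [fset perm_mnm s m | m in F].

Definition perm_orbit n (F : {fset 'X_{1..n}}) : {fset {fset 'X_{1..n}}} :=
  [fset perm_set s F | s in [set: 'S_n]].

Definition type3 (F : {fset 'X_{1..6}}) : Prop :=
  forall i : 'I_6,
    row_ones (log_matrix F) i <> 5%N /\ row_ones (log_matrix F) i <> 1%N.

(* Main.v *)
Require Import Defs.
From Stdlib Require Import ZArith.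
From mathcomp Require Import all_boot all_order all_fingroup all_algebra.
From mathcomp Require Import finmap mpoly ssrZ zify.

(* A monomial lies in Frac K[F] iff its exponent vector is an integral
   combination of those of F (compare the supports in x^m q = p), so F is a
   Cremona set of degree d iff the log vectors span the lattice generated by
   all vectors of degree d.  That lattice has the basis
   e_0 + (d-1) e_0, ..., e_n + (d-1) e_0 of determinant d, so the condition is
   |det A_F| = d.
   For n = 6 and d = 3 the orbits are enumerated through a weight on sets of
   triples: every orbit contains a set of maximal weight, a branch-and-bound
   search lists all candidates, and exactly ten of them are admissible and of
   maximal weight in their orbit.  Their weights are pairwise distinct, so they
   lie in different orbits. *)

Local Open Scope fset_scope.
Local Open Scope ring_scope.

Section MonomialCremona.

Set Implicit Arguments.
Unset Strict Implicit.
Unset Printing Implicit Defensive.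

Import Order.TTheory GRing.Theory Num.Theory.

(** * Cremona sets and determinants *)

Section FracField.

Variables (K : fieldType) (n : nat).
Implicit Types (S : {mpoly K[n]} -> Prop) (z : {fraction {mpoly K[n]}}).

Lemma frac_field_subalg S p : subalg S p -> frac_field (subalg S) (tofrac p).
Proof.
move=> Sp; exists p, 1; split; rewrite ?oner_neq0 ?tofrac1 ?divr1 //.
by rewrite -mpolyC1; apply: subalg_scalar.
Qed.

Lemma frac_fieldD S z1 z2 :
  frac_field (subalg S) z1 -> frac_field (subalg S) z2 ->
  frac_field (subalg S) (z1 + z2).
Proof.
move=> [p1 [q1 [Sp1 Sq1 q1N0 ->]]] [p2 [q2 [Sp2 Sq2 q2N0 ->]]].
exists (p1 * q2 + p2 * q1), (q1 * q2); split.
- by apply: subalg_add; apply: subalg_mul.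
- exact: subalg_mul.
- by rewrite mulf_neq0.
- by rewrite addf_div ?tofrac_eq0 // tofracD !tofracM.
Qed.

Lemma frac_fieldM S z1 z2 :
  frac_field (subalg S) z1 -> frac_field (subalg S) z2 ->
  frac_field (subalg S) (z1 * z2).
Proof.
move=> [p1 [q1 [Sp1 Sq1 q1N0 ->]]] [p2 [q2 [Sp2 Sq2 q2N0 ->]]].
exists (p1 * p2), (q1 * q2); split; try exact: subalg_mul.
  by rewrite mulf_neq0.
by rewrite mulf_div !tofracM.
Qed.

Lemma frac_fieldV S z :
  z != 0 -> frac_field (subalg S) z -> frac_field (subalg S) z^-1.
Proof.
move=> + [p [q [Sp Sq q0 def_z]]]; rewrite def_z => z0.
exists q, p; split; rewrite ?invf_div //.
by apply: contraNneq z0 => ->; rewrite tofrac0 mul0r.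
Qed.

(** Reduces an inclusion of fraction fields to generators, because [frac_field (subalg S')] contains
    the constants and is closed under sums, products and inverses. *)
Lemma frac_field_sub S S' :
  (forall p, S p -> frac_field (subalg S') (tofrac p)) ->
  forall z, frac_field (subalg S) z -> frac_field (subalg S') z.
Proof.
move=> sub z [p [q [Sp Sq q0 ->]]].
have incl r : subalg S r -> frac_field (subalg S') (tofrac r).
  elim=> {r} [c|r /sub //|r1 r2 _ IH1 _ IH2|r1 r2 _ IH1 _ IH2].
  - exact/frac_field_subalg/subalg_scalar.
  - by rewrite tofracD; apply: frac_fieldD.
  - by rewrite tofracM; apply: frac_fieldM.
apply: frac_fieldM; first exact: incl.
by apply: frac_fieldV (incl q Sq); rewrite tofrac_eq0.
Qed.

End FracField.

(** * Monomials in the fraction field as integral combinations of exponents *)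

Section Lattice.

Variables (K : fieldType) (n : nat) (F : {fset 'X_{1..n}}).
Variable (f : 'I_n -> 'X_{1..n}).
Hypothesis Ff : forall m, (m \in F) <-> exists i, m = f i.

Lemma monomial_algX (k : 'I_n -> nat) :
  monomial_alg F ('X_[\sum_i f i *+ k i]%MM : {mpoly K[n]}).
Proof.
have alg1 : monomial_alg F ('X_[0] : {mpoly K[n]}).
  by rewrite mpolyX0 -mpolyC1; apply: subalg_scalar.
elim/big_ind: _ => // [m1 m2 IH1 IH2|i _].
  by rewrite mpolyXD; apply: subalg_mul.
elim: (k i) => [|c IHc] //; rewrite mulmS mpolyXD.
apply: subalg_mul => //; apply: subalg_gen.
by exists (f i) => //; apply/Ff; exists i.
Qed.

(** The support of a sum lies in the union of the supports, that of a product in their sumset, so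
    supports never leave the semigroup generated by the [f i]. *)
Lemma msupp_monomial_alg (p : {mpoly K[n]}) m :
  monomial_alg F p -> m \in msupp p ->
  exists k : 'I_n -> nat, m = (\sum_i f i *+ k i)%MM.
Proof.
move=> Fp; elim: Fp m => {p}
  [c|_ [m' /Ff[i ->] ->]|p q _ IHp _ IHq|p q _ IHp _ IHq] m.
- rewrite msuppC; case: (c == 0); rewrite // inE => /eqP ->.
  by exists (fun=> 0%N); rewrite big1.
- move/mem_msuppXP <-; exists (fun j => (j == i)%N).
  by rewrite (bigD1 i) //= eqxx big1 ?addm0 // => j /negPf ->.
- by move/msuppD_le; rewrite mem_cat => /orP[/IHp|/IHq].
- case/msuppM_le/allpairsP => -[m1 m2] /= [/IHp[k ->] /IHq[l ->] ->].
  exists (fun i => k i + l i)%N; rewrite -big_split /=.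
  by apply: eq_bigr => i _; apply/mnmP=> j; rewrite mnmDE !mulmnE mulnDr.
Qed.

Lemma frac_monomialP m :
  frac_field (monomial_alg F) (tofrac ('X_[m] : {mpoly K[n]})) <->
  exists k l : 'I_n -> nat,
    (m + \sum_i f i *+ k i)%MM = (\sum_i f i *+ l i)%MM.
Proof.
split=> [[p [q [Fp Fq q0 /eqP]]]|[k [l def_m]]].
- rewrite -(can2_eq (mulfK _) (divfK _)) ?tofrac_eq0 // -tofracM tofrac_eq.
  move=> /eqP def_p.
  (* Any monomial of [q] would serve; the leading one exists because [q] is nonzero. Multiplication
     by ['X_[m]] shifts it into the support of [p]. *)
  have u_q := mlead_supp q0; have [k def_u] := msupp_monomial_alg Fq u_q.
  have : (m + mlead q)%MM \in msupp p.
    by rewrite -def_p mcoeff_msupp mulrC mcoeffMX -mcoeff_msupp.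
  by case/(msupp_monomial_alg Fp) => l; rewrite def_u; exists k, l.
- exists 'X_[\sum_i f i *+ l i], 'X_[\sum_i f i *+ k i].
  split; try exact: monomial_algX.
    by rewrite -msupp_eq0 msuppX.
  by rewrite -def_m mpolyXD tofracM mulfK // tofrac_eq0 -msupp_eq0 msuppX.
Qed.

Lemma frac_veroneseP d : (forall i, mdeg (f i) = d) ->
  (forall z, frac_field (@monomial_alg K n F) z <->
             frac_field (@veronese_alg K n d) z) <->
  (forall m : 'X_{1..n}, mdeg m = d -> exists k l : 'I_n -> nat,
    (m + \sum_i f i *+ k i)%MM = (\sum_i f i *+ l i)%MM).
Proof.
move=> deg_f; split=> [eqFV m deg_m|lat z].
  apply/frac_monomialP/eqFV/frac_field_subalg/subalg_gen.
  by exists m.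
split; apply: frac_field_sub => p [m].
  case/Ff => i -> ->; apply/frac_field_subalg/subalg_gen.
  by exists (f i).
by move=> /lat /frac_monomialP + ->.
Qed.

End Lattice.

(** * Spanning the degree [d] lattice as a condition on the determinant *)

Section Determinant.

Variables (n : nat) (d : nat) (f : 'I_n.+1 -> 'X_{1..n.+1}).
Hypotheses (d_gt0 : (0 < d)%N) (deg_f : forall i, mdeg (f i) = d).

(** Exponent vectors are rows here, so this is a log matrix transposed; the determinant is the
    same. *)
Let A : 'M[int]_n.+1 := \matrix_(i, j) (f i j)%:Z.

Let b (i : 'I_n.+1) : 'X_{1..n.+1} := (U_(i) + U_(ord0) *+ d.-1)%MM.
Let B : 'M[int]_n.+1 := \matrix_(i, j) (b i j)%:Z.

Let mrow (m : 'X_{1..n.+1}) : 'rV[int]_n.+1 := \row_j (m j)%:Z.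

Lemma mdeg_lattice_basis i : mdeg (b i) = d.
Proof. by rewrite mdegD mdegMn !mdeg1 mul1n add1n prednK. Qed.

Lemma det_lattice_basis : \det B = d%:Z.
Proof.
rewrite det_trig; last first.
  apply/is_trig_mxP => i j ltij; rewrite mxE mnmDE mulmnE !mnm1E.
  by rewrite -!val_eqE /= (ltn_eqF ltij) (ltn_eqF (leq_ltn_trans _ ltij)).
rewrite big_ord_recl big1 ?mulr1 => [|i _]; rewrite mxE mnmDE mulmnE !mnm1E eqxx.
  by rewrite mul1n add1n prednK.
by rewrite [ord0 == _]eq_sym -[_ == ord0]/(false).
Qed.

Lemma lattice_basis_span m :
  mdeg m = d -> exists x : 'rV[int]_n.+1, mrow m = x *m B.
Proof.
move=> deg_m.
(* All [b i] and [m] have degree [d], so the coefficients must sum to 1. The summands [(d-1) e_0]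
   then contribute exactly [(d-1) e_0], which is subtracted at index 0. *)
pose x : 'rV[int]_n.+1 := \row_i ((m i)%:Z - (i == ord0)%:Z * d.-1%:Z).
have sum_x : \sum_i x 0 i = 1.
  under eq_bigr do rewrite mxE.
  rewrite sumrB -mulr_suml (bigD1 ord0 (F := fun i => (i == ord0)%:Z)) //=.
  rewrite [X in 1%:Z + X]big1 => [|i /negPf -> //]; rewrite addr0 mul1r.
  rewrite -(big_morph Posz PoszD erefl) -mdegE deg_m.
  by rewrite -[in Posz d](prednK d_gt0) -addn1 PoszD addrC addKr.
exists x; apply/rowP => j; rewrite !mxE.
under eq_bigr do rewrite [B _ _]mxE mnmDE mulmnE !mnm1E PoszD PoszM mulrDr.
rewrite big_split /= -mulr_suml sum_x mul1r (bigD1 j) //= eqxx mulr1.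
rewrite big1 => [|i /negPf -> //]; last by rewrite mulr0.
by rewrite addr0 mxE [ord0 == j]eq_sym subrK.
Qed.

Lemma expnt_spanP m :
  (exists k l : 'I_n.+1 -> nat, (m + \sum_i f i *+ k i)%MM = (\sum_i f i *+ l i)%MM)
  <-> exists x : 'rV[int]_n.+1, mrow m = x *m A.
Proof.
have row_sum (k : 'I_n.+1 -> nat) :
    mrow (\sum_i f i *+ k i) = (\row_i (k i)%:Z) *m A.
  apply/rowP => j; rewrite !mxE mnm_sumE (big_morph Posz PoszD erefl).
  by apply: eq_bigr => i _; rewrite !mxE mulmnE PoszM mulrC.
have mrowD m1 m2 : mrow (m1 + m2)%MM = mrow m1 + mrow m2.
  by apply/rowP => j; rewrite !mxE mnmDE PoszD.
have mrow_inj m1 m2 : mrow m1 = mrow m2 -> m1 = m2.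
  by move=> /rowP eqm; apply/mnmP => j; have := eqm j; rewrite !mxE => -[].
split=> [[k [l /(congr1 mrow)]]|[x def_m]].
  rewrite mrowD !row_sum => /(canRL (addrK _)) ->.
  by rewrite -mulmxBl; exists (\row_i (l i)%:Z - \row_i (k i)%:Z).
(* Negative and positive parts of the integral coefficients. *)
pose k i := absz (Num.max (- x 0 i) 0); pose l i := absz (Num.max (x 0 i) 0).
exists k, l; apply: mrow_inj; rewrite mrowD !row_sum def_m -mulmxDl; congr (_ *m A).
apply/rowP => i; rewrite !mxE /k /l; case: (ger0P (x 0 i)) => x0.
  by rewrite max_r ?oppr_le0 // addr0 gez0_abs.
by rewrite max_l ?oppr_ge0 ?ltW // gez0_abs ?subrr // oppr_ge0 ltW.
Qed.

(** Writing [A = D *m B] gives [|det A| = |det D| * d], and the rows of [A] span the same lattice as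
    those of [B] exactly when [D] is unimodular. *)
Lemma lattice_detP :
  (forall m : 'X_{1..n.+1}, mdeg m = d -> exists k l : 'I_n.+1 -> nat,
     (m + \sum_i f i *+ k i)%MM = (\sum_i f i *+ l i)%MM)
  <-> absz (\det A) = d.
Proof.
have rows (M N : 'M[int]_n.+1) :
    (forall i, exists x : 'rV[int]_n.+1, row i M = x *m N) -> exists C, M = C *m N.
  case/fin_all_exists => x def_x; exists (\matrix_i x i).
  by apply/row_matrixP => i; rewrite row_mul rowK.
have [D def_A] : exists D, A = D *m B.
  apply: rows => i; have [x def_x] := lattice_basis_span (deg_f i).
  by exists x; rewrite -def_x; apply/rowP => j; rewrite !mxE.
have absA : absz (\det A) = (absz (\det D) * d)%N.
  by rewrite def_A det_mulmx det_lattice_basis abszM.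
split=> [lat|detA m deg_m].
  have [C def_B] : exists C, B = C *m A.
    apply: rows => i; have /expnt_spanP[x def_x] := lat _ (mdeg_lattice_basis i).
    by exists x; rewrite -def_x; apply/rowP => j; rewrite !mxE.
  (* Taking determinants in [B = C *m A] gives [d = |det C| * |det D| * d], which forces
     [|det D| = 1]. *)
  have := congr1 (absz \o determinant) def_B.
  rewrite /= det_mulmx abszM det_lattice_basis /= absA mulnA -[LHS]mul1n.
  move/eqP; rewrite eqn_pmul2r // eq_sym muln_eq1 => /andP[_ /eqP ->].
  exact: mul1n.
apply/expnt_spanP; have [x def_x] := lattice_basis_span deg_m.
have D_unit : D \in unitmx.
  have : absz (\det D) == 1%N by rewrite -(eqn_pmul2r d_gt0) -absA detA mul1n.
  by rewrite unitmxE; case: (\det D) => [[|[]]|[]].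
by exists (x *m invmx D); rewrite -mulmxA def_A mulKmx.
Qed.

End Determinant.
(** * Orbit enumeration on bit sequences *)

(* The test a 0 j == 0 only serves to prune the evaluation. *)
Fixpoint laplace (R : nzRingType) n (a : nat -> nat -> R) : R :=
  if n is n'.+1 then
    foldr (fun j s =>
      (if a 0 j == 0 then 0
       else a 0 j * ((-1) ^+ j * laplace n' (fun i k => a i.+1 (bump j k)))) + s)
      0 (iota 0 n)
  else 1.

Fixpoint bitseqs n : seq bitseq :=
  if n is n'.+1 then
    map (cons true) (bitseqs n') ++ map (cons false) (bitseqs n')
  else [:: [::]].

(** Since [bitseqs] puts [true] first, the triples come in decreasing weight. The weights are
    distinct powers of 2, so a skipped triple outweighs all later ones together, which makes the
    bound in [promising] effective. *)
Definition triples : seq bitseq := [seq b <- bitseqs 6 | count id b == 3].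

Definition act_bits (p : seq nat) (b : bitseq) : bitseq :=
  [seq nth false b i | i <- p].

(* 2^v, where v is the number with binary digits b: the weight of a set of
   triples determines the set, so the maximum over an orbit is attained at a
   single set.  This is what leaves one candidate per orbit, but the proof only
   uses the outcome of the computation. *)
Definition weight (b : bitseq) : Z :=
  Z.pow 2 (foldl (fun v c => if c then Z.succ_double v else Z.double v) Z0 b).

Definition total_weight (s : seq bitseq) : Z :=
  foldr (fun b w => Z.add (weight b) w) Z0 s.

Definition perms6 : seq (seq nat) := permutations (iota 0 6).

Definition swap i j : seq nat :=
  [seq if k == i then j else if k == j then i else k | k <- iota 0 6].

Definition swaps : seq (seq nat) := [seq swap i j | j <- iota 0 6, i <- iota 0 j].

Definition weight_max (s : seq bitseq) : bool :=
  all (fun p => Z.leb (total_weight (map (act_bits p) s)) (total_weight s)) perms6.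

(* If a set S with chosen <= S <= chosen + rest has maximal weight in its
   orbit, then w(p chosen) <= w(p S) <= w(S) <= w(chosen) + w(rest) for every
   permutation p.  Testing transpositions prunes enough. *)
Definition promising (rest chosen : seq bitseq) : bool :=
  all (fun p => Z.leb (total_weight (map (act_bits p) chosen))
                      (Z.add (total_weight chosen) (total_weight rest))) swaps.

(** [k] counts the triples still to be chosen. [chosen] accumulates in reverse order, whence
    [catrev] in the completeness statement. *)
Fixpoint search k (rest chosen : seq bitseq) : seq (seq bitseq) :=
  if ~~ promising rest chosen then [::] else
  match k, rest with
  | 0, _ => [:: chosen]
  | _.+1, [::] => [::]
  | k'.+1, b :: rest' => search k' rest' (b :: chosen) ++ search k rest' chosen
  end.

Definition log_det (s : seq bitseq) : int :=
  laplace 6 (fun i j => (nth false (nth [::] s i) j : nat)%:Z).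

Definition degree (s : seq bitseq) j : nat := count (fun b => nth false b j) s.

Definition admissible (s : seq bitseq) : bool :=
  all (fun j => (degree s j != 5) && (degree s j != 1)) (iota 0 6)
  && (absz (log_det s) == 3).

(* [if] rather than [&&]: vm_compute would evaluate both arguments of andb. *)
Definition representatives : seq (seq bitseq) :=
  [seq s <- search 6 triples [::] | (if admissible s then weight_max s else false)].


(** * Correctness of the determinant evaluation and completeness of the search *)

Lemma det_laplace (R : comNzRingType) n (a : nat -> nat -> R) :
  \det (\matrix_(i < n, j < n) a i j) = laplace n a.
Proof.
elim: n a => [|n IHn] a; first by rewrite det_mx00.
rewrite (expand_det_row _ ord0) /laplace -/laplace -[n.+1]/(n.+1).
pose t j := if a 0 j == 0 then 0 else
  a 0 j * ((-1) ^+ j * laplace n (fun i k => a i.+1 (bump j k))).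
transitivity (\sum_(j < n.+1) t j).
  apply: eq_bigr => j _; rewrite mxE /t; case: eqP => [->|_]; rewrite ?mul0r //.
  congr (_ * _); rewrite /cofactor add0n -IHn; congr (_ * \det _).
  by apply/matrixP => i k; rewrite !mxE.
by rewrite -(big_mkord xpredT) /index_iota subn0 unlock.
Qed.

Lemma mem_bitseqs n b : (b \in bitseqs n) = (size b == n).
Proof.
elim: n b => [|n IHn] [|c b] //=; rewrite mem_cat.
  by apply/orP => -[] /mapP[].
rewrite eqSS -IHn; apply/orP/idP => [[] /mapP[? ? [_ ->]] //|bn].
by case: c; [left | right]; apply: map_f.
Qed.

Lemma total_weightE s : total_weight s = \sum_(b <- s) weight b.
Proof. by elim: s => [|b s IHs]; rewrite ?big_nil // big_cons -IHs. Qed.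

Lemma total_weight_catrev s t :
  total_weight (catrev s t) = total_weight s + total_weight t.
Proof. by rewrite catrevE !total_weightE big_cat (perm_big s) // perm_rev. Qed.

Lemma weight_ge0 b : (0 <= weight b)%R.
Proof. by apply/Z.leb_le/Z.pow_nonneg. Qed.

Lemma total_weight_ge0 s : (0 <= total_weight s)%R.
Proof. by rewrite total_weightE; apply: sumr_ge0 => b _; apply: weight_ge0. Qed.

Lemma perm_total_weight s t : perm_eq s t -> total_weight s = total_weight t.
Proof. by move=> st; rewrite !total_weightE (perm_big t). Qed.

(** The computation also certifies the shape of the lists found, so no general soundness statement
    about [search] has to be proved. *)
Lemma representatives_check :
  [&& size representatives == 10, uniq (map total_weight representatives)
    & all (fun r => [&& uniq r, size r == 6 & all (mem triples) r]) representatives].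
Proof. by vm_compute. Qed.

Lemma swaps_sub : {subset swaps <= perms6}.
Proof.
have: all (perm_eq (iota 0 6)) swaps by vm_compute.
by move/allP => sw p /sw; rewrite mem_permutations perm_sym.
Qed.

(** Follow the branch that keeps [b] exactly when [P b]. Maximality of the final set makes every
    node on this path [promising], so it is never pruned. *)
Lemma mem_search (P : pred bitseq) rest chosen :
  weight_max (catrev (filter P rest) chosen) ->
  catrev (filter P rest) chosen \in search (count P rest) rest chosen.
Proof.
have prom rest' ch : weight_max (catrev (filter P rest') ch) -> promising rest' ch.
  move=> /allP max_s; apply/allP => p /swaps_sub /max_s.
  rewrite catrevE map_cat map_rev -!catrevE !total_weight_catrev => le_w.
  have w_filter : (total_weight (filter P rest') <= total_weight rest')%R.
    rewrite !total_weightE big_filter [leRHS](bigID P) /= lerDl.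
    by apply: sumr_ge0 => b _; apply: weight_ge0.
  have /= := total_weight_ge0 (map (act_bits p) (filter P rest')).
  rewrite /promising; lia.
elim: rest chosen => [|b rest IHrest] chosen max_s; rewrite /= (prom _ _ max_s) /=.
  by rewrite inE.
case: (boolP (P b)) max_s => Pb /=; rewrite ?(negPf Pb) ?Pb /= => max_s.
  by rewrite add1n mem_cat IHrest.
(* With nothing left to choose, the search stops at once even if [rest] is nonempty. *)
rewrite add0n; case def_k: (count P rest) => [|k].
  have /nilP -> : nilp (filter P rest) by rewrite /nilp size_filter def_k.
  by rewrite /= inE.
by rewrite mem_cat -def_k IHrest ?orbT.
Qed.
(** * From sets of monomials to bit sequences *)

Lemma perm_mnm_inj n (s : 'S_n) : injective (@perm_mnm n s).
Proof.
move=> m1 m2 /mnmP eq_m; apply/mnmP => i.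
by have := eq_m (s i); rewrite !mnmE permK.
Qed.

Lemma enum_perm_set n (s : 'S_n) (F : {fset 'X_{1..n}}) :
  perm_eq (perm_set s F) (map (perm_mnm s) F).
Proof. by apply: enum_imfset => x y _ _; apply: perm_mnm_inj. Qed.

(** Products of permutations apply the left factor first, hence the order [t * s]. *)
Lemma perm_set_comp n (s t : 'S_n) (F : {fset 'X_{1..n}}) :
  perm_set s (perm_set t F) = perm_set (t * s)%g F.
Proof.
have comp m : perm_mnm s (perm_mnm t m) = perm_mnm (t * s)%g m.
  by apply/mnmP => i; rewrite !mnmE invMg permM.
apply/fsetP => m; apply/imfsetP/imfsetP => /= -[m' F_m' ->].
  by case/imfsetP: F_m' => /= m'' F_m'' ->; exists m''; rewrite ?comp.
by exists (perm_mnm t m'); rewrite ?comp //; apply: in_imfset.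
Qed.

Lemma perm_set1 n (F : {fset 'X_{1..n}}) : perm_set 1%g F = F.
Proof.
have id_m m : perm_mnm 1%g m = m :> 'X_{1..n}.
  by apply/mnmP => i; rewrite mnmE invg1 perm1.
apply/fsetP => m; apply/imfsetP/idP => /= [[m' Fm' ->]|Fm]; first by rewrite id_m.
by exists m.
Qed.

Lemma perm_orbitP n (F G : {fset 'X_{1..n}}) :
  reflect (exists s, G = perm_set s F) (G \in perm_orbit F).
Proof.
apply: (iffP (imfsetP _ _ _ _)) => /= -[s]; first by exists s.
by move=> ->; exists s; rewrite ?inE.
Qed.

Lemma perm_orbit_perm_set n (s : 'S_n) (F : {fset 'X_{1..n}}) :
  perm_orbit (perm_set s F) = perm_orbit F.
Proof.
apply/fsetP => G; apply/perm_orbitP/perm_orbitP => -[t ->].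
  by exists (s * t)%g; rewrite perm_set_comp.
by exists (s^-1 * t)%g; rewrite perm_set_comp mulKVg.
Qed.

Lemma mdeg_perm_mnm n (s : 'S_n) (m : 'X_{1..n}) : mdeg (perm_mnm s m) = mdeg m.
Proof.
rewrite !mdegE (reindex_perm s) /=; apply: eq_bigr => i _.
by rewrite mnmE permK.
Qed.

Lemma cremona_setP (K : fieldType) n d (F : {fset 'X_{1..n}})
    (f : 'I_n -> 'X_{1..n}) :
  #|` F| = n -> (forall i, mdeg (f i) = d) ->
  (forall m, (m \in F) <-> exists i, m = f i) ->
  cremona_set K d F <->
  (forall m : 'X_{1..n}, mdeg m = d -> exists k l : 'I_n -> nat,
    (m + \sum_i f i *+ k i)%MM = (\sum_i f i *+ l i)%MM).
Proof.
move=> cardF deg_f Ff; split=> [[_ _ /(frac_veroneseP _ Ff deg_f)] //|lat].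
split=> [//|m /Ff[i ->] //|]; exact/(frac_veroneseP _ Ff deg_f).
Qed.

Lemma cremona_perm_set (K : fieldType) n d (s : 'S_n) (F : {fset 'X_{1..n}}) :
  cremona_set K d F -> cremona_set K d (perm_set s F).
Proof.
move=> cremF; have [cardF degF _] := cremF.
pose f (i : 'I_n) := nth 0%MM F i.
have Ff m : (m \in F) <-> exists i, m = f i.
  split=> [Fm|[i ->]]; last by rewrite mem_nth ?cardF.
  have im : (index m F < n)%N by rewrite -[X in (_ < X)%N]cardF index_mem.
  by exists (Ordinal im); rewrite /f nth_index.
have deg_f i : mdeg (f i) = d by apply/degF/Ff; exists i.
have lat := (cremona_setP K cardF deg_f Ff).1 cremF.
apply/(cremona_setP K (f := perm_mnm s \o f)).
- by rewrite card_imfset //; apply: perm_mnm_inj.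
- by move=> i; rewrite /= mdeg_perm_mnm.
- move=> m; split=> [/imfsetP[/= m' /Ff[i ->] ->]|[i ->]]; first by exists i.
  by apply: in_imfset; apply/Ff; exists i.
(* A relation for [perm_mnm s^-1 m] over [f] becomes one for [m] over the permuted monomials with
   the same [k] and [l]: coordinate [i] is read off at [s^-1 i]. *)
move=> m deg_m; have [|k [l /mnmP eq_kl]] := lat (perm_mnm s^-1 m).
  by rewrite mdeg_perm_mnm.
exists k, l; apply/mnmP => i; have := eq_kl ((s^-1)%g i).
rewrite !mnmDE !mnm_sumE mnmE invgK permKV.
under eq_bigr do rewrite mulmnE; under [X in _ = X]eq_bigr do rewrite mulmnE.
under [X in _ -> (_ + X = _)%N]eq_bigr do rewrite mulmnE mnmE.
by under [X in _ -> _ = X]eq_bigr do rewrite mulmnE mnmE.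
Qed.

Lemma row_onesE n (F : {fset 'X_{1..n}}) i :
  row_ones (log_matrix F) i = count (fun m : 'X_{1..n} => m i == 1%N) F.
Proof.
rewrite /row_ones -sum1_count big_tnth -sum1_card.
by apply: eq_bigl => j; rewrite inE mxE.
Qed.

Lemma row_ones_perm_set n (s : 'S_n) (F : {fset 'X_{1..n}}) i :
  row_ones (log_matrix (perm_set s F)) i = row_ones (log_matrix F) ((s^-1)%g i).
Proof.
rewrite !row_onesE (seq.permP (enum_perm_set s F)) count_map.
by apply: eq_count => m /=; rewrite mnmE.
Qed.

Lemma square_free_mnmP n (m : 'X_{1..n}) :
  square_free_mnm m <-> forall i, (m i <= 1)%N.
Proof.
split=> sq i; last first.
  apply/mnm_lepP => /(_ i); rewrite mulmnE mnm1E eqxx mul1n.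
  by move/leq_trans/(_ (sq i)).
rewrite leqNgt; apply: contraNN (sq i) => m_i; apply/mnm_lepP => j.
by rewrite mulmnE mnm1E; case: eqP => [<-|_]; rewrite ?mul1n.
Qed.

Lemma square_free_perm_set n (s : 'S_n) (F : {fset 'X_{1..n}}) :
  square_free_set F -> square_free_set (perm_set s F).
Proof.
move=> sqF _ /imfsetP[/= m /sqF /square_free_mnmP sq_m ->].
by apply/square_free_mnmP => i; rewrite mnmE.
Qed.

(** * Encoding of square free monomials in six variables *)

Definition mnm_of_bits (b : bitseq) : 'X_{1..6} :=
  [multinom (nth false b i : nat) | i < 6].

Definition bits_of_mnm (m : 'X_{1..6}) : bitseq :=
  [seq m i == 1%N | i <- enum 'I_6].

Definition fset_of_bits (s : seq bitseq) : {fset 'X_{1..6}} :=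
  [fset mnm_of_bits b | b in s].

Lemma nth_bits_of_mnm m (i : 'I_6) : nth false (bits_of_mnm m) i = (m i == 1%N).
Proof. by rewrite (nth_map i) ?size_enum_ord // nth_ord_enum. Qed.

Lemma mnm_of_bitsK b : size b = 6%N -> bits_of_mnm (mnm_of_bits b) = b.
Proof.
move=> size_b; apply: (eq_from_nth (x0 := false)); rewrite size_map size_enum_ord //.
by move=> i lti; rewrite (nth_bits_of_mnm _ (Ordinal lti)) mnmE eqb1.
Qed.

Lemma bits_of_mnmK m : square_free_mnm m -> mnm_of_bits (bits_of_mnm m) = m.
Proof.
move/square_free_mnmP => sq_m; apply/mnmP => i; rewrite mnmE nth_bits_of_mnm.
by case: (m i) (sq_m i) => [|[]].
Qed.

Lemma square_free_mnm_of_bits b : square_free_mnm (mnm_of_bits b).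
Proof. by apply/square_free_mnmP => i; rewrite mnmE leq_b1. Qed.

Lemma mdeg_square_free m :
  square_free_mnm m -> mdeg m = count id (bits_of_mnm m).
Proof.
move/square_free_mnmP => sq_m; rewrite mdegE count_map -sum1_count.
rewrite big_enum_cond [RHS]big_mkcond /=.
by apply: eq_bigr => i _; case: (m i) (sq_m i) => [|[]].
Qed.

Lemma mem_triples b : (b \in triples) = (size b == 6%N) && (count id b == 3%N).
Proof. by rewrite mem_filter mem_bitseqs andbC. Qed.

Lemma bits_of_mnm_triple m :
  square_free_mnm m -> mdeg m = 3%N -> bits_of_mnm m \in triples.
Proof.
move=> sq_m deg_m.
by rewrite mem_triples size_map size_enum_ord -mdeg_square_free ?deg_m.
Qed.

Lemma mdeg_triple b : b \in triples -> mdeg (mnm_of_bits b) = 3%N.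
Proof.
rewrite mem_triples => /andP[/eqP size_b /eqP b3].
by rewrite mdeg_square_free ?mnm_of_bitsK //; apply: square_free_mnm_of_bits.
Qed.

(* perm_mnm s reads off exponents along s^-1. *)
Definition inv_word (s : 'S_6) : seq nat := [seq (s^-1%g i : nat) | i <- enum 'I_6].

Lemma bits_of_perm_mnm s m :
  bits_of_mnm (perm_mnm s m) = act_bits (inv_word s) (bits_of_mnm m).
Proof.
rewrite /act_bits -map_comp; apply: eq_map => i /=.
by rewrite nth_bits_of_mnm mnmE.
Qed.

Lemma inv_word_perms6 s : inv_word s \in perms6.
Proof.
rewrite mem_permutations; apply: uniq_perm; rewrite ?iota_uniq //.
  by rewrite map_inj_uniq ?enum_uniq // => i j /val_inj /perm_inj.
move=> k; rewrite mem_iota; apply/mapP/idP => [[i _ ->]|ltk]; first exact: ltn_ord.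
by exists (s (Ordinal ltk)); rewrite ?mem_enum // permK.
Qed.

Lemma perms6P p : p \in perms6 -> exists s, p = inv_word s.
Proof.
rewrite mem_permutations => perm_p.
have size_p : size p = 6%N by rewrite (perm_size perm_p).
have lt_p (i : 'I_6) : (nth 0%N p i < 6)%N.
  have : nth 0%N p i \in iota 0 6 by rewrite -(perm_mem perm_p) mem_nth ?size_p.
  by rewrite mem_iota.
have inj_p : injective (fun i : 'I_6 => Ordinal (lt_p i)).
  move=> i j /(congr1 val) /eqP /=.
  rewrite nth_uniq ?size_p // ?(perm_uniq perm_p) ?iota_uniq //.
  by move/eqP/val_inj.
(* The inverse is taken because [inv_word] lists the values of the inverse permutation. *)
exists (perm inj_p)^-1%g; rewrite /inv_word invgK.
apply: (@eq_from_nth _ 0%N) => [|k]; rewrite size_p.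
  by rewrite size_map size_enum_ord.
move=> ltk; rewrite (nth_map (Ordinal ltk)) ?size_enum_ord //.
by rewrite (nth_ord_enum _ (Ordinal ltk)) permE.
Qed.

Lemma mem_fset_of_bits s m : (m \in fset_of_bits s) = (m \in map mnm_of_bits s).
Proof. by apply/imfsetP/mapP => /= -[b s_b ->]; exists b. Qed.

Lemma mnm_of_bits_inj : {in triples &, injective mnm_of_bits}.
Proof.
move=> b c; rewrite !mem_triples => /andP[/eqP sb _] /andP[/eqP sc _].
by move/(congr1 bits_of_mnm); rewrite !mnm_of_bitsK.
Qed.

Lemma square_free_fset_of_bits s : square_free_set (fset_of_bits s).
Proof. by move=> _ /imfsetP[b _ ->]; apply: square_free_mnm_of_bits. Qed.

Lemma enum_fset_of_bits s : uniq s -> {subset s <= triples} ->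
  perm_eq (fset_of_bits s) (map mnm_of_bits s).
Proof.
move=> uniq_s s_triples; apply: uniq_perm => [||m]; rewrite ?mem_fset_of_bits //.
by rewrite map_inj_in_uniq // => b c /s_triples + /s_triples; apply: mnm_of_bits_inj.
Qed.

Definition triples_of (F : {fset 'X_{1..6}}) : seq bitseq :=
  [seq b <- triples | mnm_of_bits b \in F].

Lemma triples_ofK F :
  square_free_set F -> (forall m, m \in F -> mdeg m = 3%N) ->
  fset_of_bits (triples_of F) = F.
Proof.
move=> sqF degF; apply/fsetP => m; apply/imfsetP/idP => /= [[b]|Fm].
  by rewrite mem_filter => /andP[? _] ->.
exists (bits_of_mnm m); last by rewrite bits_of_mnmK; last exact: sqF.
by rewrite mem_filter bits_of_mnmK ?Fm ?bits_of_mnm_triple ?degF //; apply: sqF.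
Qed.

Lemma card_fset_of_bits s :
  uniq s -> {subset s <= triples} -> #|` fset_of_bits s| = size s.
Proof. by move=> us st; rewrite (perm_size (enum_fset_of_bits us st)) size_map. Qed.

(** By the determinant criterion the Cremona condition is an integer test independent of [K], and
    the row counts of the log matrix are the values of [degree]. *)
Lemma admissibleP (K : fieldType) s :
  uniq s -> {subset s <= triples} -> size s = 6%N ->
  admissible s <-> cremona_set K 3 (fset_of_bits s) /\ type3 (fset_of_bits s).
Proof.
move=> us st size_s.
pose f (i : 'I_6) := mnm_of_bits (nth [::] s i).
have Ff m : (m \in fset_of_bits s) <-> exists i, m = f i.
  rewrite mem_fset_of_bits; split=> [/mapP[b s_b ->]|[i ->]]; last first.
    by apply/map_f/mem_nth; rewrite size_s.
  have ib : (index b s < 6)%N by rewrite -size_s index_mem.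
  by exists (Ordinal ib); rewrite /f nth_index.
have deg_f i : mdeg (f i) = 3%N by apply/mdeg_triple/st/mem_nth; rewrite size_s.
have cardF : #|` fset_of_bits s| = 6%N by rewrite card_fset_of_bits.
have crem : cremona_set K 3 (fset_of_bits s) <-> absz (log_det s) = 3%N.
  rewrite (cremona_setP K cardF deg_f Ff) (lattice_detP _ deg_f) //.
  rewrite /log_det -det_laplace.
  suff -> : \matrix_(i, j) (f i j)%:Z = \matrix_(i, j)
      ((nth false (nth [::] s i) j : nat) : int) by [].
  by apply/matrixP => i j; rewrite !mxE mnmE.
have row_degree i : row_ones (log_matrix (fset_of_bits s)) i = degree s i.
  rewrite row_onesE (seq.permP (enum_fset_of_bits us st)) count_map.
  by apply: eq_count => b /=; rewrite mnmE eqb1.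
rewrite crem /admissible; split=> [/andP[/allP degs /eqP]|[-> t3]].
  split=> // i; have : (i : nat) \in iota 0 6 by rewrite mem_iota ltn_ord.
  by move/degs; rewrite row_degree => /andP[/eqP ? /eqP].
rewrite eqxx andbT; apply/allP => j; rewrite mem_iota => /andP[_ ltj].
by have [] := t3 (Ordinal ltj); rewrite row_degree => /eqP -> /eqP ->.
Qed.

Lemma uniq_map_inj_in (T U : eqType) (f : T -> U) (s : seq T) :
  uniq (map f s) -> {in s &, injective f}.
Proof.
elim: s => //= x s IHs /andP[fx /IHs inj_s] y z; rewrite !inE.
case/predU1P=> [->|sy] /predU1P[->|sz] // eq_f; last exact: inj_s.
  by rewrite eq_f map_f in fx.
by rewrite -eq_f map_f in fx.
Qed.

Lemma card_imfset_seq (T T' : choiceType) (f : T -> T') (s : seq T) :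
  uniq s -> {in s &, injective f} -> #|` [fset f x | x in s]| = size s.
Proof. by move=> us f_inj; rewrite card_in_imfset //= undup_id. Qed.

Lemma representativesP r : r \in representatives ->
  [/\ uniq r, {subset r <= triples}, size r = 6%N, admissible r & weight_max r].
Proof.
move=> rep_r; have /and3P[_ _ /allP/(_ _ rep_r)] := representatives_check.
move=> /and3P[? /eqP ? /allP ?].
by move: rep_r; rewrite mem_filter; case: (admissible r) => // /andP[].
Qed.

Definition fset_weight (F : {fset 'X_{1..6}}) : Z :=
  total_weight (map bits_of_mnm F).

Lemma weight_perm_fset_of_bits s r : uniq r -> {subset r <= triples} ->
  fset_weight (perm_set s (fset_of_bits r)) =
  total_weight (map (act_bits (inv_word s)) r).
Proof.
move=> ur rt; apply: perm_total_weight.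
rewrite (perm_trans (perm_map _ (enum_perm_set _ _))) //.
rewrite -map_comp (perm_trans (perm_map _ (enum_fset_of_bits ur rt))) // -map_comp.
rewrite (_ : map _ r = map (act_bits (inv_word s)) r) //.
apply/eq_in_map => b /rt; rewrite mem_triples => /andP[/eqP sb _] /=.
by rewrite bits_of_perm_mnm mnm_of_bitsK.
Qed.

Lemma weight_fset_of_bits r : uniq r -> {subset r <= triples} ->
  fset_weight (fset_of_bits r) = total_weight r.
Proof.
move=> ur rt; apply: perm_total_weight.
rewrite (perm_trans (perm_map _ (enum_fset_of_bits ur rt))) // -map_comp.
rewrite (_ : map _ r = r) // -[RHS]map_id.
apply/eq_in_map => b /rt; rewrite mem_triples => /andP[/eqP sb _] /=.
exact: mnm_of_bitsK.
Qed.

(** The words in [perms6] are exactly the [inv_word s], so the finite test ranges over the whole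
    orbit. *)
Lemma weight_maxP r : uniq r -> {subset r <= triples} ->
  weight_max r <->
  forall s, (fset_weight (perm_set s (fset_of_bits r))
             <= fset_weight (fset_of_bits r))%R.
Proof.
move=> ur rt; split=> [/allP max_r s|max_r].
  rewrite weight_perm_fset_of_bits // weight_fset_of_bits //.
  exact/max_r/inv_word_perms6.
apply/allP => _ /perms6P[s ->].
by have := max_r s; rewrite weight_perm_fset_of_bits // weight_fset_of_bits.
Qed.

(** Two representatives in one orbit both attain its maximal weight, and weights in the list are
    pairwise distinct. *)
Lemma perm_orbit_representatives_inj :
  {in representatives &, injective (fun r => perm_orbit (fset_of_bits r))}.
Proof.
have le_w r r' : r \in representatives -> r' \in representatives ->
    perm_orbit (fset_of_bits r) = perm_orbit (fset_of_bits r') ->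
    (total_weight r <= total_weight r')%R.
  move=> /representativesP[ur rt _ _ _] /representativesP[ur' rt' _ _ max_r'] eq_orb.
  rewrite -!weight_fset_of_bits //.
  have : fset_of_bits r \in perm_orbit (fset_of_bits r').
    by rewrite -eq_orb; apply/perm_orbitP; exists 1%g; rewrite perm_set1.
  by move=> /perm_orbitP[s ->]; apply: (weight_maxP ur' rt').1.
move=> r r' rep_r rep_r' /= eq_orb.
have /and3P[_ uniq_w _] := representatives_check.
have eq_w : total_weight r = total_weight r'.
  by apply/le_anti/andP; split; [exact: (le_w _ _ rep_r) | exact: (le_w _ _ rep_r')].
exact: (uniq_map_inj_in uniq_w).
Qed.

Lemma representatives_complete (K : fieldType) F :
  cremona_set K 3 F -> square_free_set F -> type3 F ->
  exists2 r, r \in representatives & perm_orbit F = perm_orbit (fset_of_bits r).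
Proof.
move=> cremF sqF t3F.
have [s _ max_s] :=
  @arg_maxP _ Z 'S_6 1%g xpredT (fun s => fset_weight (perm_set s F)) isT.
set G := perm_set s F in max_s.
have [cardG degG _] := cremona_perm_set s cremF.
have sqG := @square_free_perm_set _ s _ sqF.
(* Reversed to agree with the order in which [search] accumulates its choices. *)
pose r := rev (triples_of G).
have ur : uniq r by rewrite rev_uniq filter_uniq.
have rt : {subset r <= triples}.
  by move=> b; rewrite mem_rev mem_filter => /andP[].
have famr : fset_of_bits r = G.
  rewrite -[RHS](triples_ofK sqG degG); apply/fsetP => m.
  by rewrite !mem_fset_of_bits map_rev mem_rev.
have size_r : size r = 6%N by rewrite -card_fset_of_bits // famr.
exists r; last by rewrite famr perm_orbit_perm_set.
have max_r : weight_max r.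
  apply/(weight_maxP ur rt) => t; rewrite famr perm_set_comp; exact: max_s.
have adm_r : admissible r.
  apply/(admissibleP K ur rt size_r); rewrite famr; split.
    exact: cremona_perm_set.
  by move=> i; rewrite row_ones_perm_set.
rewrite mem_filter adm_r max_r andTb.
(* The search depth 6 is rewritten as the number of triples selected by membership in [G], the form
   required by [mem_search]. *)
have <- : count (fun b => mnm_of_bits b \in G) triples = 6%N.
  by rewrite -size_filter -[RHS]size_r size_rev.
exact: mem_search max_r.
Qed.

End MonomialCremona.

Theorem proposition20 (K : fieldType) :
  exists classes : {fset {fset {fset 'X_{1..6}}}},
    #|` classes| = 10%N /\
    forall C : {fset {fset 'X_{1..6}}},
      C \in classes <->
      exists F : {fset 'X_{1..6}},
        [/\ cremona_set K 3 F, square_free_set F, type3 F & C = perm_orbit F].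
Proof.
have /and3P[/eqP size_reps uniq_w _] := representatives_check.
exists [fset perm_orbit (fset_of_bits r) | r in representatives]; split.
  (* Distinct weights also show that the list of representatives has no repetition. *)
  apply: etrans size_reps; apply: card_imfset_seq (map_uniq uniq_w) _.
  exact: perm_orbit_representatives_inj.
move=> C; split=> [/imfsetP[r /representativesP[ur rt size_r adm_r _] ->]|].
  have [cremr t3r] := (admissibleP K ur rt size_r).1 adm_r.
  exists (fset_of_bits r).
  by split; [exact: cremr | exact: square_free_fset_of_bits | exact: t3r | ].
move=> [F [cremF sqF t3F ->]].
have [r rep_r ->] := representatives_complete cremF sqF t3F.
by apply/imfsetP; exists r.
Qed.
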